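(* Let $V \in \mathbb{R}^{m \times n}$ with $n \geq m$ and $y \in \mathbb{R}^m$, and suppose that for some $r$: (i) $\operatorname{rank}(V_{(:,(1:r))}) = \operatorname{rank}(V) = r$; (ii) $V = V_{(:,(1:r))} V_{(:,(1:r))}^\dagger V$. Let $u^\ast \in \mathbb{R}^n$ be a solution to the problem $(\ell_0)$: minimize $\|u\|_{\ell_0}$ over $u \in \mathbb{R}^n$ subject to $Vu = y$. Then $u^\ast$ is not a solution of the problem (BP): minimize $\|u\|_{\ell_1}$ over $u\in\mathbb{R}^n$ subject to $Vu=y$, if there exists an index $i^\ast \in \{r+1,\dots,n\}$ with $u^\ast_{i^\ast} \neq 0$ and $$\|V_{(:,(1:r))}^\dagger V_{(:,\{i^\ast\})}\|_{\ell_1} < 1.$$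
   Context: For a matrix $V$, $V_{(:,(1:r))}$ denotes the submatrix consisting of the first $r$ columns of $V$, and $V_{(:,\{i\})}$ denotes the $i$-th column of $V$. $X^\dagger$ denotes the Moore–Penrose inverse of $X$. $\|u\|_{\ell_0} = \sum_{i=1}^n |\operatorname{sign}(u_i)|$ is the number of non-zero entries of $u$ and $\|u\|_{\ell_1} = \sum_i |u_i|$. A solution of a minimization problem means a feasible global minimizer. *)

(* Defs.v *)
From mathcomp Require Import all_boot all_order all_algebra.
From mathcomp Require Import reals.
Set Implicit Arguments.
Unset Strict Implicit.
Unset Printing Implicit Defensive.
Import Order.TTheory GRing.Theory Num.Theory.
Local Open Scope ring_scope.

Definition first_cols (R : realType) (m n r : nat) (hr : (r <= n)%N)
    (V : 'M[R]_(m, n)) : 'M[R]_(m, r) := colsub (widen_ord hr) V.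

Definition is_mpinv (R : realType) (m n : nat)
    (A : 'M[R]_(m, n)) (X : 'M[R]_(n, m)) : Prop :=
  [/\ A *m X *m A = A, X *m A *m X = X,
      (A *m X)^T = A *m X & (X *m A)^T = X *m A].

(* The Moore-Penrose inverse, from the full rank factorization A = C B with
   C = col_base A and B = row_base A; [mpinvP] characterizes it as the unique
   solution of the Penrose equations. Not to be confused with the library's
   [pinvmx], which is only some generalized inverse. *)
Definition mpinv (R : realType) (m n : nat) (A : 'M[R]_(m, n)) : 'M[R]_(n, m) :=
  let C := col_base A in let B := row_base A in
  B^T *m invmx (B *m B^T) *m invmx (C^T *m C) *m C^T.

Lemma gram_unit (R : realType) (k n : nat) (B : 'M[R]_(k, n)) :
  row_free B -> B *m B^T \in unitmx.
Proof.
move=> fB; rewrite -row_free_unit -kermx_eq0; apply/eqP/row_matrixP => i.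
rewrite row0; set w := row i _.
have w0 : w *m (B *m B^T) = 0 by rewrite -row_mul mulmx_ker row0.
have wB : w *m B = 0.
  have : (w *m B) *m (w *m B)^T = 0 by rewrite trmx_mul mulmxA -(mulmxA w) w0 mul0mx.
  move/matrixP/(_ 0 0); rewrite !mxE => /eqP.
  rewrite psumr_eq0 => [/allP s0|j _]; last by rewrite [(_^T) _ _]mxE -expr2 sqr_ge0.
  apply/rowP => j; have := s0 j (mem_index_enum _).
  by rewrite [(_^T) _ _]mxE mulf_eq0 orbb [RHS]mxE => /eqP.
by apply: (row_free_inj fB); rewrite wB mul0mx.
Qed.

Lemma full_rank_is_mpinv (R : realType) (m n k : nat)
    (C : 'M[R]_(m, k)) (B : 'M[R]_(k, n)) :
  B *m B^T \in unitmx -> C^T *m C \in unitmx ->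
  is_mpinv (C *m B) (B^T *m invmx (B *m B^T) *m invmx (C^T *m C) *m C^T).
Proof.
move=> uB uC; set IB := invmx _; set IC := invmx _.
have VB p (M : 'M_(p, _)) : M *m B *m B^T *m IB = M.
  by rewrite -(mulmxA M) -mulmxA [X in M *m X]mulmxV // mulmx1.
have KB p (M : 'M_(p, _)) : M *m IB *m B *m B^T = M.
  by rewrite -!mulmxA [X in M *m X]mulVmx // mulmx1.
have KC p (M : 'M_(p, _)) : M *m IC *m C^T *m C = M.
  by rewrite -!mulmxA [X in M *m X]mulVmx // mulmx1.
have AX : C *m B *m (B^T *m IB *m IC *m C^T) = C *m IC *m C^T.
  by rewrite !mulmxA VB.
have XA : B^T *m IB *m IC *m C^T *m (C *m B) = B^T *m IB *m B.
  by rewrite !mulmxA KC.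
split; rewrite ?AX ?XA.
- by rewrite !mulmxA KC.
- by rewrite !mulmxA KB.
- by rewrite !trmx_mul trmxK trmx_inv trmx_mul trmxK mulmxA.
- by rewrite !trmx_mul trmxK trmx_inv trmx_mul trmxK mulmxA.
Qed.

Lemma mpinv_is_mpinv (R : realType) (m n : nat) (A : 'M[R]_(m, n)) :
  is_mpinv A (mpinv A).
Proof.
rewrite -[X in is_mpinv X _]mulmx_base; apply: full_rank_is_mpinv.
  exact/gram_unit/row_base_free.
rewrite -[X in _ *m X]trmxK; apply: gram_unit.
by rewrite /row_free mxrank_tr; have := col_base_full A.
Qed.

Lemma is_mpinv_uniq (R : realType) (m n : nat) (A : 'M[R]_(m, n))
    (X Y : 'M[R]_(n, m)) : is_mpinv A X -> is_mpinv A Y -> X = Y.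
Proof.
case=> x1 x2 x3 x4 [y1 y2 y3 y4].
have AXY : A *m X = A *m Y.
  by rewrite -x3 -{1}y1 -!mulmxA (mulmxA A Y) trmx_mul x3 y3 mulmxA x1.
have XYA : X *m A = Y *m A.
  by rewrite -x4 -{1}y1 -(mulmxA A) mulmxA trmx_mul x4 y4 -mulmxA (mulmxA A) x1.
by rewrite -x2 XYA -mulmxA AXY mulmxA y2.
Qed.

Lemma mpinvP (R : realType) (m n : nat) (A : 'M[R]_(m, n)) (X : 'M[R]_(n, m)) :
  is_mpinv A X <-> X = mpinv A.
Proof.
split=> [/is_mpinv_uniq|->]; last exact: mpinv_is_mpinv.
by apply; apply: mpinv_is_mpinv.
Qed.

Definition l0norm (R : realType) (n : nat) (u : 'cV[R]_n) : R :=
  \sum_(i < n) `|Num.sg (u i 0)|.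

Definition l1norm (R : realType) (n : nat) (u : 'cV[R]_n) : R :=
  \sum_(i < n) `|u i 0|.

Definition is_solution (R : realType) (m n : nat) (f : 'cV[R]_n -> R)
    (V : 'M[R]_(m, n)) (y : 'cV[R]_m) (u : 'cV[R]_n) : Prop :=
  V *m u = y /\ forall w : 'cV[R]_n, V *m w = y -> f u <= f w.

(* Main.v *)
(* Put x = mpinv (first_cols V) *m col i V.  Condition (ii) says that the first
   r columns of V combine with coefficients x to its i-th column, so the weight
   u_i can be moved from entry i to the first r entries without changing V u.
   This changes the l1 norm by at most |u_i| (||x||_1 - 1) < 0. *)
Require Import Defs.
From mathcomp Require Import all_boot all_order all_algebra.
From mathcomp Require Import reals.
Import Order.TTheory GRing.Theory Num.Theory.
Local Open Scope ring_scope.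

Lemma l1normD (R : realType) (n : nat) (u v : 'cV[R]_n) :
  l1norm (u + v) <= l1norm u + l1norm v.
Proof.
by rewrite -big_split; apply: ler_sum => j _; rewrite mxE ler_normD.
Qed.

Lemma l1normZ (R : realType) (n : nat) (a : R) (u : 'cV[R]_n) :
  l1norm (a *: u) = `|a| * l1norm u.
Proof. by rewrite mulr_sumr; apply: eq_bigr => j _; rewrite mxE normrM. Qed.

Lemma l1norm_remove_entry (R : realType) (n : nat) (u : 'cV[R]_n) (i : 'I_n) :
  l1norm (u - u i 0 *: delta_mx i 0) = l1norm u - `|u i 0|.
Proof.
rewrite /l1norm (bigD1 i) //= [in RHS](bigD1 i) //= addrC addrAC subrr add0r.
rewrite !mxE !eqxx mulr1 subrr normr0 addr0.
by apply: eq_bigr => j /negbTE ji; rewrite !mxE ji mulr0 subr0.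
Qed.

(** [first_cols hr 1%:M] acts on a vector of length r by appending n - r zeros; this turns
    combinations of the first columns into products with [V]. *)
Lemma first_colsE (R : realType) (m n r : nat) (hr : (r <= n)%N)
    (V : 'M[R]_(m, n)) : first_cols hr V = V *m first_cols hr 1%:M.
Proof. by rewrite /first_cols mulmx_colsub mulmx1. Qed.

(** After the triangle inequality and an exchange of sums, each [x k 0] is counted once, as every
    column of the padding matrix has a single 1. *)
Lemma l1norm_first_cols1 (R : realType) (n r : nat) (hr : (r <= n)%N)
    (x : 'cV[R]_r) : l1norm (first_cols hr 1%:M *m x) <= l1norm x.
Proof.
apply: (@le_trans _ _
  (\sum_(j < n) \sum_(k < r) (j == widen_ord hr k)%:R * `|x k 0|)).
  apply: ler_sum => j _; rewrite mxE.
  apply: le_trans (ler_norm_sum _ _ _) _; apply: ler_sum => k _.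
  by rewrite !mxE normrM normr_nat.
rewrite exchange_big; apply: ler_sum => k _.
rewrite (bigD1 (widen_ord hr k)) //= eqxx mul1r big1 ?addr0 // => j /negbTE->.
by rewrite mul0r.
Qed.

Theorem theorem1 (R : realType) (m n r : nat) (hmn : (m <= n)%N)
    (hr : (r <= n)%N) (V : 'M[R]_(m, n)) (y : 'cV[R]_m)
    (hrank : \rank (first_cols hr V) = r /\ \rank V = r)
    (hV : V = first_cols hr V *m mpinv (first_cols hr V) *m V)
    (u : 'cV[R]_n) (hu : is_solution (@l0norm R n) V y u)
    (hi : exists i : 'I_n,
       [/\ (r <= i)%N, u i 0 != 0 &
           l1norm (mpinv (first_cols hr V) *m col i V) < 1]) :
  ~ is_solution (@l1norm R n) V y u.
Proof.
case: hi => i [_ ui0]; set x := _ *m col i V => x1 [Vu umin].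
have Vx : V *m (first_cols hr 1%:M *m x) = V *m delta_mx i 0.
  (* With [col i V] written as [V *m delta_mx i 0], condition (ii) absorbs the projector in front of
     [V]. *)
  by rewrite mulmxA -first_colsE /x colE (mulmxA _ _ (_ *m _)) mulmxA -hV.
set w := u - u i 0 *: delta_mx i 0 + u i 0 *: (first_cols hr 1%:M *m x).
have Vw : V *m w = y.
  by rewrite mulmxDr mulmxBr -!scalemxAr Vx subrK.
have := umin w Vw; apply/negP; rewrite -ltNge.
apply: le_lt_trans (l1normD _ _ _ _) _.
(* Cancelling [l1norm u] and then the positive factor [|u i 0|] leaves only that the padded [x] has
   norm below 1. *)
rewrite l1norm_remove_entry l1normZ addrAC -addrA gtrDl subr_lt0.
rewrite gtr_pMr ?normr_gt0 //.
exact: le_lt_trans (l1norm_first_cols1 _ _ _ _ _) x1.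
Qed.
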